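(* Let $\Gamma \leq \mathrm{Homeo}_{+}(I)$ be a subgroup with finite height $h(\Gamma) = N$. Then $\Gamma$ is solvable of solvability degree (derived length) at most $N$.
   Context: $I=[0,1]$ and $\mathrm{Homeo}_{+}(I)$ is the group of orientation-preserving homeomorphisms of $I$. For a subgroup $G \le \mathrm{Homeo}_+(I)$, an orbital of $G$ is the convex hull of the $G$-orbit of a point of $I$, provided this convex hull contains more than one point; orbitals are open intervals. For $g \in G$, an orbital of $g$ means an orbital of the cyclic group $\langle g\rangle$ (equivalently, a connected component of $I \setminus \mathrm{Fix}(g)$). A signed orbital of $G$ is a pair $(A,g)$ with $g\in G$ and $A$ an orbital of $g$; $g$ is called its signature. A tower $T$ of $G$ is a set of signed orbitals of $G$ such that the intervals occurring as first coordinates form a chain under inclusion, and for each interval $A$ occurring as a first coordinate in $T$ there is exactly one element of $T$ of the form $(A,g)$. Let $O_T$ denote the set of intervals occurring as first coordinates in $T$; the height of the tower $T$ is the cardinality of $O_T$. The height $h(G)$ of $G$ is the supremum of the heights of the towers of $G$ if this supremum is finite, and $h(G)=\infty$ otherwise. *)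

(* Defs.v *)
From HB Require Import structures.
From mathcomp Require Import all_boot all_order all_algebra.
From mathcomp Require Import all_classical all_reals all_analysis.

Set Implicit Arguments.
Unset Strict Implicit.
Unset Printing Implicit Defensive.

Import Order.TTheory GRing.Theory Num.Theory.
Import numFieldNormedType.Exports.

Local Open Scope classical_set_scope.
Local Open Scope ring_scope.

Section Subgroups.
Local Open Scope group_scope.
Context {gT : groupType}.
Implicit Types G H S : set gT.

Definition is_subgroup H : Prop := group_closed [in H].

Definition generated S : set gT := smallest is_subgroup S.

Definition derived_subgroup G : set gT :=
  generated [set commg x y | x in G & y in G].

Definition derived_series G (n : nat) : set gT := iter n derived_subgroup G.

Definition has_derived_length G (n : nat) : Prop :=
  derived_series G n = [set 1] /\
  (forall m : nat, derived_series G m = [set 1] -> (n <= m)%N).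

End Subgroups.

(* [0, 1] as a type, with the topology induced from R *)
Definition unit_itv (R : realType) : Type := set_type `[0%R : R, 1%R]%classic.

HB.instance Definition _ (R : realType) := Topological.on (unit_itv R).

(* Orientation-preserving means strictly increasing.  The inverse map is data,
   but it is determined by the homeomorphism (see [homeoI_inj]). *)
Record homeoI (R : realType) := HomeoI {
  homeo_fun :> unit_itv R -> unit_itv R;
  homeo_inv : unit_itv R -> unit_itv R;
  homeo_funK : cancel homeo_fun homeo_inv;
  homeo_invK : cancel homeo_inv homeo_fun;
  homeo_fun_continuous : continuous homeo_fun;
  homeo_inv_continuous : continuous homeo_inv;
  homeo_fun_increasing : {homo homeo_fun : x y / \val x < \val y} }.

Section HomeoGroup.
Context {R : realType}.
Implicit Types f g h : homeoI R.

Lemma homeoI_inj f g : homeo_fun f =1 homeo_fun g -> f = g.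
Proof.
case: f => f f' fK f'K cf cf' mf; case: g => g g' gK g'K cg cg' mg /= /funext fg.
case: _ / fg in gK g'K cg mg *.
have f'g' : f' = g' by apply/funext => x; rewrite -[in LHS](g'K x) fK.
case: _ / f'g' in gK g'K cg' *.
by congr HomeoI; exact: Prop_irrelevance.
Qed.

Lemma homeo_inv_increasing f : {homo homeo_inv f : x y / \val x < \val y}.
Proof.
move=> x y xy; rewrite ltNge le_eqVlt; apply/negP => /orP[/eqP/val_inj yx|yx].
  by move: xy; rewrite -(homeo_invK f x) -yx homeo_invK ltxx.
by move/(homeo_fun_increasing f): yx; rewrite !homeo_invK ltNge (ltW xy).
Qed.

Definition homeo_one : homeoI R :=
  @HomeoI R id id (fun=> erefl) (fun=> erefl)
    (fun x => cvg_id) (fun x => cvg_id) (fun x y xy => xy).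

Definition homeo_inverse f : homeoI R :=
  HomeoI (homeo_invK f) (homeo_funK f)
    (@homeo_inv_continuous R f) (@homeo_fun_continuous R f)
    (@homeo_inv_increasing f).

Lemma homeo_comp_continuous f g : continuous (f \o g).
Proof.
by move=> x; apply: continuous_comp;
  [exact: homeo_fun_continuous | exact: homeo_fun_continuous].
Qed.

Lemma homeo_comp_inv_continuous f g : continuous (homeo_inv g \o homeo_inv f).
Proof.
by move=> x; apply: continuous_comp;
  [exact: homeo_inv_continuous | exact: homeo_inv_continuous].
Qed.

Lemma homeo_comp_increasing f g : {homo f \o g : x y / \val x < \val y}.
Proof. by move=> x y xy; do 2 apply: homeo_fun_increasing. Qed.

Definition homeo_comp f g : homeoI R :=
  HomeoI (can_comp (homeo_funK f) (homeo_funK g))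
    (can_comp (homeo_invK g) (homeo_invK f))
    (@homeo_comp_continuous f g) (@homeo_comp_inv_continuous f g)
    (@homeo_comp_increasing f g).

HB.instance Definition _ := gen_eqMixin (homeoI R).
HB.instance Definition _ := gen_choiceMixin (homeoI R).

Lemma homeo_compA : associative homeo_comp.
Proof. by move=> f g h; exact: homeoI_inj. Qed.

Lemma homeo_comp1f : left_id homeo_one homeo_comp.
Proof. by move=> f; exact: homeoI_inj. Qed.

Lemma homeo_compf1 : right_id homeo_one homeo_comp.
Proof. by move=> f; exact: homeoI_inj. Qed.

Lemma homeo_compVf : left_inverse homeo_one homeo_inverse homeo_comp.
Proof. by move=> f; apply: homeoI_inj => x; exact: homeo_funK. Qed.

Lemma homeo_compfV : right_inverse homeo_one homeo_inverse homeo_comp.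
Proof. by move=> f; apply: homeoI_inj => x; exact: homeo_invK. Qed.

HB.instance Definition _ := isGroup.Build (homeoI R)
  homeo_compA homeo_comp1f homeo_compf1 homeo_compVf homeo_compfV.

End HomeoGroup.

Section Towers.
Context {R : realType}.
Implicit Types (G : set (homeoI R)) (A : set R) (T : set (set R * homeoI R)).

Definition orbit_of G (x : unit_itv R) : set R := [set \val (g x) | g in G].

Definition convex_hull (S : set R) : set R := smallest (@convex_set R R^o) S.

Definition is_orbital G A : Prop :=
  exists2 x : unit_itv R, A = convex_hull (orbit_of G x) & ~ is_subset1 A.

Definition signed_orbitals G : set (set R * homeoI R) :=
  [set Ag | G Ag.2 /\ is_orbital (generated [set Ag.2]) Ag.1].

Definition tower_intervals T : set (set R) := [set Ag.1 | Ag in T].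

Definition is_tower G T : Prop :=
  [/\ T `<=` signed_orbitals G,
      total_on (tower_intervals T) subset
    & forall A, tower_intervals T A -> exists! g, T (A, g)].

Definition tower_height T : \bar R := counting (tower_intervals T).

(* The empty tower makes the supremum range over a nonempty set. *)
Definition height G : \bar R := ereal_sup [set tower_height T | T in is_tower G].

End Towers.

(* Main.v *)
Require Import Defs.
From mathcomp Require Import all_boot all_order all_algebra.
From mathcomp Require Import finmap ring lra.
From mathcomp Require Import all_classical all_reals all_analysis.

Set Implicit Arguments.
Unset Strict Implicit.
Unset Printing Implicit Defensive.

Import Order.TTheory GRing.Theory Num.Theory.

(** Write [(a, b)] for an orbital of an element [g]: [g] fixes [a] and [b] and
    no point in between, and it moves all points in between in the same
    direction. Finite height says that the chains of strictly nested orbitals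
    of elements of the group have bounded length, so every nonempty family of
    orbitals has minimal and maximal members.

    Finite height is restrictive. If [f] mapped an orbital properly into itself,
    its iterates would give an infinite chain ([no_self_nesting]). If two
    orbitals overlapped without being nested, a minimal overlapped orbital
    would either be mapped properly into itself or contain a smaller
    overlapped one ([no_overlap]). So any two orbitals are nested or
    disjoint.

    Let [A] be a maximal orbital. An element that moved an endpoint of [A] would
    have an orbital strictly larger than [A], so the whole group [G] acts on [A].
    The elements with a fixed point in [A] form a subgroup, because orbitals do
    not overlap ([fixed_point_mul]); an element without one moves all of [A] up
    or down, by powers that are unbounded in [A]. Comparing elements by their
    action on [A] is therefore an archimedean bi-invariant preorder, and by
    Hoelder's argument ([commg_in_cone]) commutators have fixed points in [A].
    Hence so do all elements of the derived subgroup
    ([derived_fixed_point]), which thus does not have [A] as an orbital.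

    A chain of orbitals of the derived subgroup can then be prolonged by a
    maximal orbital of [G], so passing to the derived subgroup lowers the
    bound on chains by one ([derived_chain_bound]). After [N] steps no
    orbital is left, and the group is trivial. *)

(** * Subgroups *)

Section Subgroups.
Local Open Scope classical_set_scope.
Local Open Scope group_scope.
Context {gT : groupType}.
Implicit Types (G H : set gT) (f g : gT).

Lemma is_subgroupP G :
  is_subgroup G <-> G 1 /\ (forall f g, G f -> G g -> G (f / g)).
Proof.
split=> -[G1 GD]; split; first exact: set_mem.
- by move=> f g Gf Gg; apply: set_mem; apply: GD; exact: mem_set.
- exact: mem_set.
- by move=> f g /set_mem Gf /set_mem Gg; apply: mem_set; exact: GD.
Qed.

Lemma subgroup1 G : is_subgroup G -> G 1.
Proof. by move=> /is_subgroupP[]. Qed.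

Lemma subgroupV G f : is_subgroup G -> G f -> G f^-1.
Proof. by move=> /is_subgroupP[G1 GD] Gf; rewrite -[f^-1]mul1g; exact: GD. Qed.

Lemma subgroupM G f g : is_subgroup G -> G f -> G g -> G (f * g).
Proof.
move=> sG Gf Gg; rewrite -[g]invgK; case/is_subgroupP: (sG) => _; apply=> //.
exact: subgroupV.
Qed.

Lemma subgroupX G f n : is_subgroup G -> G f -> G (f ^+ n).
Proof.
move=> sG Gf; elim: n => [|n IHn]; first exact: subgroup1.
by rewrite expgS; exact: subgroupM.
Qed.

Lemma subgroupJ G f g : is_subgroup G -> G f -> G g -> G (f ^ g).
Proof.
move=> sG Gf Gg; apply: subgroupM => //; first exact: subgroupV.
exact: subgroupM.
Qed.

Lemma subgroupR G f g : is_subgroup G -> G f -> G g -> G (commg f g).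
Proof.
move=> sG Gf Gg; apply: subgroupM => //; first exact: subgroupV.
exact: subgroupJ.
Qed.

Lemma generated_subgroup (S : set gT) : is_subgroup (generated S).
Proof.
apply/is_subgroupP; split=> [|f g Sf Sg] K SK.
  by case: SK => /subgroup1.
by case: (SK) => /is_subgroupP[_ KD] _; apply: KD; [exact: Sf | exact: Sg].
Qed.

Lemma derived_subgroup_sub G K : is_subgroup K ->
  (forall f g, G f -> G g -> K (commg f g)) -> derived_subgroup G `<=` K.
Proof. by move=> sK GK; apply: smallest_sub => // _ [f Gf [g Gg <-]]; exact: GK. Qed.

Lemma derived_subgroup_sub_self G : is_subgroup G -> derived_subgroup G `<=` G.
Proof.
by move=> sG; apply: (derived_subgroup_sub sG) => f g Gf Gg; exact: subgroupR.
Qed.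

End Subgroups.

(** * Archimedean bi-invariant preorders *)

Section Hoelder.
Local Open Scope classical_set_scope.
Local Open Scope group_scope.
Context {gT : groupType}.
Implicit Types (G Q : set gT) (f g : gT).

(** The nonnegative elements of a bi-invariant total preorder on [G], in which
    [q] and [q^-1] may both be nonnegative without [q] being trivial. *)
Record archimedean_cone G Q : Prop := ArchimedeanCone {
  cone_sub : Q `<=` G;
  cone1 : Q 1;
  coneM : forall p q, Q p -> Q q -> Q (p * q);
  coneJ : forall q g, Q q -> G g -> Q (q ^ g);
  cone_total : forall g, G g -> Q g \/ Q g^-1;
  cone_archimedean : forall f g, G f -> G g -> ~ Q f^-1 ->
    exists n, Q (g^-1 * f ^+ n) }.

Variables (G Q : set gT).
Hypotheses (sG : is_subgroup G) (coneQ : archimedean_cone G Q).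

Let le f g := Q (f^-1 * g).

Let le_trans g f h : le f g -> le g h -> le f h.
Proof. by move=> fg /(coneM coneQ fg); rewrite /le mulgA mulgK. Qed.

Let le_total f g : G f -> G g -> le f g \/ le g f.
Proof.
move=> Gf Gg; have := cone_total coneQ (subgroupM sG (subgroupV sG Gf) Gg).
by rewrite invgM invgK.
Qed.

Let le_mul f g f' g' : G f' -> le f g -> le f' g' -> le (f * f') (g * g').
Proof.
move=> Gf' /(coneJ coneQ)/(_ Gf') + le'; move=> /(coneM coneQ)/(_ le').
by rewrite /le conjgE invgM !mulgA mulgK.
Qed.

Let le_mul2l h f g : le (h * f) (h * g) <-> le f g.
Proof. by rewrite /le invgM mulgA mulgVK. Qed.

Let le_mul2r h f g : G h -> le (f * h) (g * h) <-> le f g.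
Proof.
move=> Gh; have E : (f * h)^-1 * (g * h) = (f^-1 * g) ^ h.
  by rewrite conjgE invgM !mulgA.
rewrite /le E; split=> [|Qfg]; last exact: (coneJ coneQ).
by move=> /(coneJ coneQ)/(_ (subgroupV sG Gh)); rewrite conjgK.
Qed.

Let lt_mul f g f' g' : G f -> G f' -> G g -> G g' ->
  ~ le g f -> ~ le g' f' -> ~ le (g * g') (f * f').
Proof.
move=> Gf Gf' Gg Gg' gf g'f' h; apply: gf.
have f'g' : le f' g' by case: (le_total Gf' Gg').
apply/(le_mul2r _ _ Gf'); apply: le_trans h; exact/le_mul2l.
Qed.

(** The integral part of [f] with respect to the unit [t]. *)
Let floor t f : G t -> ~ le t 1 -> G f -> le 1 f ->
  exists n, le (t ^+ n) f /\ ~ le (t ^+ n.+1) f.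
Proof.
move=> Gt t1 Gf f1.
have [m fm] : exists m, ~ le (t ^+ m) f.
  have [|n fn] := cone_archimedean coneQ Gt Gf.
    by move=> Qt; apply: t1; rewrite /le mulg1.
  exists n.+1; rewrite expgSr => h; apply: t1.
  by apply/(le_mul2l (t ^+ n)); rewrite mulg1; exact: le_trans h fn.
elim: m fm => [|m IHm] fm; first by case: fm.
by have [/IHm//|/contrapT h] := pselect (~ le (t ^+ m) f); exists m.
Qed.

(** Hoelder's argument.  If [c = [f, g]] were strictly positive, [f] and [g]
    could be located to within a factor [t] between consecutive powers of any
    strictly positive [t], which locates [fg] and [gf] between the same two
    powers [t ^+ k] and [t ^+ k.+2] and forces [c < t ^+ 2].  If some [t] lies
    strictly between [1] and [c], then [t] or [t^-1 c] has square at most [c].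
    Otherwise [c] is a least strictly positive element, and then [f] and [g] are
    equivalent to powers of [c], so that [fg] and [gf] are equivalent. *)
Let commg_le1 f g : G f -> G g -> le 1 f -> le 1 g -> le (commg f g) 1.
Proof.
move=> Gf Gg f1 g1; apply: contrapT => c1.
set c := commg f g in c1.
have E : f * g = g * f * c by rewrite -commgC.
have Gc : G c by exact: subgroupR.
have ltle a b : G a -> G b -> ~ le a b -> le b a.
  by move=> Ga Gb; have [] := le_total Ga Gb.
have GX n t : G t -> G (t ^+ n) by exact: subgroupX.
have [[t [Gt t1 ct]]|least] :=
    pselect (exists t, [/\ G t, ~ le t 1 & ~ le c t]).
  have [v [Gv v1 vc]] : exists v, [/\ G v, ~ le v 1 & le (v ^+ 2) c].
    have [tc|tc] := pselect (le (t ^+ 2) c); first by exists t.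
    have Gu : G (t^-1 * c) by apply: subgroupM => //; exact: subgroupV.
    exists (t^-1 * c); split=> //.
      by move/(le_mul2l t); rewrite mulgA mulgV mul1g mulg1.
    have ut : le (t^-1 * c) t.
      apply/(le_mul2l t); rewrite mulgA mulgV mul1g -expg2.
      by apply: ltle => //; exact: GX.
    have := (le_mul2r (t^-1 * c) t Gu).2 ut; by rewrite mulVKg expg2.
  have [m [mf fm]] := floor Gv v1 Gf f1.
  have [n [ng gn]] := floor Gv v1 Gg g1.
  apply: (lt_mul Gf Gg (GX _ _ Gv) (GX _ _ Gv) fm gn).
  rewrite -expgnDr addSn addnS addnC -addn2 expgnDr E.
  apply: le_mul => //; first exact: GX.
  by rewrite expgnDr; apply: le_mul => //; exact: GX.
have c_pow h : G h -> le 1 h -> exists n, le (c ^+ n) h /\ le h (c ^+ n).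
  move=> Gh h1; have [n [nh hn]] := floor Gc c1 Gh h1.
  exists n; split=> //.
  have Gr : G ((c ^+ n)^-1 * h).
    by apply: subgroupM => //; apply: subgroupV => //; exact: GX.
  apply: contrapT => hcn; apply: least; exists ((c ^+ n)^-1 * h); split=> //.
    by move/(le_mul2l (c ^+ n)); rewrite mulVKg mulg1.
  by move/(le_mul2l (c ^+ n)); rewrite mulVKg -expgSr.
have [m [mf fm]] := c_pow _ Gf f1.
have [n [ng gn]] := c_pow _ Gg g1.
apply: c1; apply/(le_mul2l (g * f)); rewrite -E mulg1.
apply: (@le_trans (c ^+ (n + m))).
  by rewrite addnC expgnDr; apply: le_mul.
by rewrite expgnDr; apply: le_mul => //; exact: GX.
Qed.

Lemma commg_in_cone f g : G f -> G g -> Q (commg f g).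
Proof.
have le1 h : le 1 h <-> Q h by rewrite /le invg1 mul1g.
have base a b : G a -> G b -> Q a -> Q b -> Q (commg a b) /\ Q (commg a b)^-1.
  move=> Ga Gb /le1 a1 /le1 b1.
  have := commg_le1 Ga Gb a1 b1; have := commg_le1 Gb Ga b1 a1.
  by rewrite /le !mulg1 invgR.
have GV h : G h -> G h^-1 by exact: subgroupV.
(* [[f, g^-1]] is conjugate to the inverse of [[f, g]], which reduces the
   claim to nonnegative [f] and [g] *)
have semi a b : G a -> G b -> Q a -> Q (commg a b) /\ Q (commg a b)^-1.
  move=> Ga Gb Qa; have [Qb|Qb] := cone_total coneQ Gb; first exact: base.
  have E : commg a b = (commg a b^-1)^-1 ^ b.
    by rewrite invgR /commg !conjgE invgK -!mulgA mulKg.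
  have [q q'] := base _ _ Ga (GV _ Gb) Qa Qb.
  by rewrite E -conjVg invgK; split; apply: (coneJ coneQ).
move=> Gf Gg; have [Qf|Qf] := cone_total coneQ Gf.
  by case: (semi f g Gf Gg Qf).
have E : commg f g = (commg f^-1 g)^-1 ^ f.
  by rewrite invgR /commg !conjgE !invgK -!mulgA mulVg mulg1.
by rewrite E; apply: (coneJ coneQ) => //; case: (semi f^-1 g (GV _ Gf) Gg Qf).
Qed.

End Hoelder.

(** * Homeomorphisms as order automorphisms of the real line *)

Section Action.
Local Open Scope classical_set_scope.
Local Open Scope ring_scope.
Context {R : realType}.
Implicit Types (f g h : homeoI R) (a b c d x y z : R).

(** Extending by the identity outside the unit interval gives access to suprema
    and arithmetic on the real line, and makes every point that moves lie
    between two fixed points. *)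
Definition act g x : R :=
  if insub x is Some u then \val (g (u : unit_itv R)) else x.

Lemma act_val g (u : unit_itv R) : act g (\val u) = \val (g u).
Proof. by rewrite /act valK. Qed.

Lemma act_out g x : ~~ (0 <= x <= 1) -> act g x = x.
Proof.
move=> x01; rewrite /act insubF//; apply/negbTE; apply: contra x01.
by rewrite inE/= in_itv.
Qed.

Lemma itv01P x : 0 <= x <= 1 -> exists u : unit_itv R, \val u = x.
Proof.
move=> x01; have x01' : x \in `[0 : R, 1]%classic by rewrite inE/= in_itv.
by exists (SigSub x01').
Qed.

Lemma unit_itvP (u : unit_itv R) : 0 <= \val u <= 1.
Proof. by have := valP u; rewrite inE/= in_itv. Qed.

Lemma act1 x : act 1%g x = x.
Proof.
have [/itv01P[u <-]|/act_out//] := boolP (0 <= x <= 1).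
by rewrite act_val.
Qed.

Lemma actM f g x : act (f * g)%g x = act f (act g x).
Proof.
have [/itv01P[u <-]|x01] := boolP (0 <= x <= 1); first by rewrite !act_val.
by rewrite !act_out.
Qed.

Lemma actK g : cancel (act g) (act g^-1%g).
Proof. by move=> x; rewrite -actM mulVg act1. Qed.

Lemma actVK g : cancel (act g^-1%g) (act g).
Proof. by move=> x; rewrite -actM mulgV act1. Qed.

Lemma act_homo g : {homo act g : x y / x < y}.
Proof.
move=> x y xy; have [/itv01P[u ux]|x01] := boolP (0 <= x <= 1);
  have [/itv01P[v vy]|y01] := boolP (0 <= y <= 1).
- by rewrite -ux -vy !act_val; apply: homeo_fun_increasing; rewrite ux vy.
- rewrite (act_out g y01) -ux act_val.
  have := unit_itvP (g u); have := unit_itvP u; rewrite ux => u01 gu01.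
  move: y01; rewrite negb_and -!ltNge => /orP[]; lra.
- rewrite (act_out g x01) -vy act_val.
  have := unit_itvP (g v); have := unit_itvP v; rewrite vy => v01 gv01.
  move: x01; rewrite negb_and -!ltNge => /orP[]; lra.
- by rewrite !act_out.
Qed.

Lemma act_le g : {mono act g : x y / x <= y}.
Proof. exact/le_mono/act_homo. Qed.

Lemma act_lt g : {mono act g : x y / x < y}.
Proof. exact/leW_mono/act_le. Qed.

Lemma act_inj g : injective (act g).
Proof. exact: can_inj (actK g). Qed.

Lemma actV_fix g x : act g x = x -> act g^-1%g x = x.
Proof. by move=> gx; rewrite -{1}gx actK. Qed.

Lemma act_eq1 g : (forall x, act g x = x) -> g = 1%g.
Proof. by move=> gx; apply: homeoI_inj => u; apply: val_inj; rewrite -act_val gx. Qed.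

Lemma actV_gt g x : (x < act g^-1%g x) = (act g x < x).
Proof. by rewrite -(act_lt g) actVK. Qed.

Lemma actV_lt g x : (act g^-1%g x < x) = (x < act g x).
Proof. by rewrite -(act_lt g) actVK. Qed.

(** An order automorphism commutes with suprema, so it fixes the supremum of
    the points below [y] that it moves up. *)
Lemma act_fix_between_down g x y : x < y -> x < act g x -> act g y < y ->
  exists s, x < s < y /\ act g s = s.
Proof.
move=> xy xgx gyy; pose S := [set z | z <= y /\ z < act g z].
have Sx : S x by split=> //; exact: ltW.
have ubS : has_ubound S by exists y => z [].
have supS : has_sup S by split=> //; exists x.
have leS z : S z -> z <= sup S by exact: ub_le_sup.
have Sy : sup S <= y by apply: ge_sup; [exists x|move=> z []].
have fixS : act g (sup S) = sup S.
  apply/eqP; rewrite eq_le !leNgt; apply/andP; split; apply/negP => h.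
    have ltSy : sup S < y.
      rewrite lt_neqAle Sy andbT; apply: contraPneq gyy => <-.
      by apply/negP; rewrite -leNgt ltW.
    have zS : sup S < Num.min (act g (sup S)) y by rewrite lt_min h.
    have : S (Num.min (act g (sup S)) y).
      split; first by rewrite ge_min lexx orbT.
      by apply: (@le_lt_trans _ _ (act g (sup S))); rewrite ?ge_min ?lexx// act_lt.
    by move/leS; rewrite leNgt zS.
  have [z Sz gz] : exists2 z, S z & act g (sup S) < z by apply: sup_gt => //; exists x.
  have : act g z <= act g (sup S) by rewrite act_le leS.
  by move=> /le_lt_trans/(_ gz); case: Sz => _ /lt_trans h' /h'; rewrite ltxx.
exists (sup S); split=> //; rewrite !lt_neqAle (leS _ Sx) Sy !andbT.
by apply/andP; split; apply/eqP; [move: xgx => + xS | move: gyy => + yS];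
  rewrite ?xS -?yS fixS ltxx.
Qed.

Lemma act_fix_between_up g x y : x < y -> act g x < x -> y < act g y ->
  exists s, x < s < y /\ act g s = s.
Proof.
move=> xy gx gy; have [||s [sxy /actV_fix]] := @act_fix_between_down g^-1%g _ _ xy.
- by rewrite actV_gt.
- by rewrite actV_lt.
- by rewrite invgK; exists s.
Qed.

(** * Bumps: the components of the complement of the fixed set *)

Definition is_bump g a b :=
  [/\ a < b, act g a = a, act g b = b
    & forall x, a < x -> x < b -> act g x <> x].

Definition moves_up g a b := forall x, a < x -> x < b -> x < act g x.

Lemma bumpV g a b : is_bump g a b -> is_bump g^-1%g a b.
Proof.
case=> ab ga gb gx; split; rewrite ?actV_fix// => x ax xb /actV_fix.
by rewrite invgK; exact: gx.
Qed.

Lemma bumpJ f g a b : is_bump g a b -> is_bump (g ^ f^-1)%g (act f a) (act f b).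
Proof.
case=> ab ga gb gx.
have gJ x : act (g ^ f^-1)%g (act f x) = act f (act g x).
  by rewrite conjgE invgK !actM actK.
split; rewrite ?act_lt ?gJ ?ga ?gb// => x; rewrite -{1 2}[x](actVK f) !act_lt => ax xb.
by rewrite -{1 2}[x](actVK f) gJ => /act_inj; exact: gx.
Qed.

Lemma bump_up_or_down g a b : is_bump g a b -> moves_up g a b \/ moves_up g^-1%g a b.
Proof.
case=> ab ga gb gx; have [up|nup] := pselect (moves_up g a b); [by left|right].
move=> y ay yb; rewrite actV_gt; apply: contrapT => /negP; rewrite -leNgt => ygy.
have {}ygy : y < act g y by rewrite lt_neqAle ygy andbT; apply/eqP/nesym/gx.
apply: nup => x ax xb; apply: contrapT => /negP; rewrite -leNgt => xgx.
have {}xgx : act g x < x by rewrite lt_neqAle xgx andbT; apply/eqP/gx.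
have [xy|yx|xy] := ltgtP x y.
- have [s [/andP[xs sy]]] := act_fix_between_up xy xgx ygy.
  by apply: gx; [exact: lt_trans xs|exact: lt_trans yb].
- have [s [/andP[xs sy]]] := act_fix_between_down yx ygy xgx.
  by apply: gx; [exact: lt_trans xs|exact: lt_trans xb].
- by move: xgx ygy; rewrite xy => /lt_trans h /h; rewrite ltxx.
Qed.

(** The endpoints are the nearest fixed points on either side of [x], a
    supremum and an infimum of fixed points being fixed. *)
Lemma bump_around g x : act g x <> x -> exists a b, is_bump g a b /\ a < x < b.
Proof.
move=> gx; pose F := [set z | act g z = z].
pose L := [set z | F z /\ z <= x]; pose U := [set z | F z /\ x <= z].
have supL : has_sup L.
  split; last by exists x => z [].
  (* every point below 0 is fixed *)
  exists (Num.min (-1) x); split; last by rewrite ge_min lexx orbT.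
  have [h|h] := leP (-1) x; first by apply: act_out; lra.
  by apply: act_out; lra.
have infU : has_inf U.
  split; last by exists x => z [].
  (* every point above 1 is fixed *)
  exists (Num.max 2 x); split; last by rewrite le_max lexx orbT.
  have [h|h] := leP 2 x; first by apply: act_out; lra.
  by apply: act_out; lra.
have leL z : L z -> z <= sup L by move=> ?; apply: ub_le_sup => //; case: supL.
have leU z : U z -> inf U <= z by move=> ?; apply: ge_inf => //; case: infU.
have Lx : sup L <= x by apply: ge_sup; [case: supL|move=> z []].
have xU : x <= inf U by apply: lb_le_inf; [case: infU|move=> z []].
have FL : F (sup L).
  suff noup g' : (forall z, F z -> act g' z = z) -> ~ sup L < act g' (sup L).
    apply/eqP; rewrite eq_le !leNgt; apply/andP; split; apply/negP.
      exact: noup.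
    by rewrite -actV_gt; apply: noup => z; exact: actV_fix.
  move=> g'F; rewrite -actV_lt => /sup_gt[|z Lz]; first by case: supL.
  rewrite -(act_lt g') actVK (g'F z (proj1 Lz)) => /lt_le_trans/(_ (leL _ Lz)).
  by rewrite ltxx.
have FU : F (inf U).
  suff nodown g' : (forall z, F z -> act g' z = z) -> ~ act g' (inf U) < inf U.
    apply/eqP; rewrite eq_le !leNgt; apply/andP; split; apply/negP; last exact: nodown.
    by rewrite -actV_lt; apply: nodown => z; exact: actV_fix.
  move=> g'F; rewrite -actV_gt => /inf_lt[|z Uz]; first by case: infU.
  rewrite -(act_lt g') actVK (g'F z (proj1 Uz)) => /(le_lt_trans (leU _ Uz)).
  by rewrite ltxx.
have ax : sup L < x by rewrite lt_neqAle Lx andbT; apply: contra_not_neq gx => <-.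
have xb : x < inf U by rewrite lt_neqAle xU andbT; apply: contra_not_neq gx => ->.
exists (sup L), (inf U); rewrite ax xb; split=> //; split=> //.
  exact: lt_trans xb.
move=> z az zb gz; have [zx|/ltW xz] := leP z x.
  by move: az; apply/negP; rewrite -leNgt leL.
by move: zb; apply/negP; rewrite -leNgt leU.
Qed.

(** Otherwise the supremum of the orbit would be a fixed point in the bump. *)
Lemma orbit_cofinal g a b x y : is_bump g a b -> moves_up g a b ->
  a < x < b -> y < b -> exists n, y < act (g ^+ n)%g x.
Proof.
move=> bg up /andP[ax xb] yb; apply: contrapT => nex.
pose S := [set act (g ^+ n)%g x | n in setT].
have Sx : S x by exists 0%N; rewrite ?expg0 ?act1.
have ubS : ubound S y.
  by move=> _ [n _ <-]; rewrite leNgt; apply/negP => h; apply: nex; exists n.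
have supS : has_sup S by split; [exists x|exists y].
have leS z : S z -> z <= sup S by apply: ub_le_sup; case: supS.
have aS : a < sup S by exact: lt_le_trans ax (leS _ Sx).
have Sb : sup S < b by apply: le_lt_trans yb; apply: ge_sup => //; case: supS.
have := up _ aS Sb; rewrite -actV_lt => /sup_gt[|_ [n _ <-]]; first by case: supS.
rewrite -(act_lt g) actVK -actM -expgS => h.
by have := leS _ (ex_intro2 _ _ n.+1 I erefl); rewrite leNgt h.
Qed.

End Action.

(** * Chains of nested orbitals *)

Section Chains.
Local Open Scope classical_set_scope.
Local Open Scope ring_scope.

(** If the chains for [e] in [P] have bounded length, climbing from [x] as long
    as possible reaches a member of [P] with nothing above it. *)
Lemma ex_terminal (T : eqType) (e : rel T) (P : T -> Prop) (N : nat) (x : T) :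
  transitive e ->
  (forall s, sorted e s -> (forall y, y \in s -> P y) -> (size s <= N)%N) ->
  P x -> exists y, [/\ P y, y = x \/ e y x & forall z, P z -> ~~ e z y].
Proof.
move=> e_tr bnd Px; apply: contrapT => noterm.
have ext y : P y -> y = x \/ e y x -> exists z, [/\ P z, e z x & e z y].
  move=> Py yx; apply: contrapT => noext; apply: noterm.
  exists y; split=> // z Pz; apply/negP => zy; apply: noext.
  by exists z; split=> //; case: yx => [<-//|]; exact: e_tr.
have long n : exists y s, [/\ size s = n, sorted e (y :: s),
    forall z, z \in y :: s -> P z & y = x \/ e y x].
  elim: n => [|n [y [s [sn ys Ps yx]]]].
    by exists x, [::]; split=> //; [move=> z; rewrite inE => /eqP->|left].
  have [z [Pz zx zy]] := ext y (Ps _ (mem_head _ _)) yx.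
  exists z, (y :: s); split=> //=; [by rewrite sn|by rewrite zy| |by right].
  by move=> w; rewrite inE => /predU1P[->//|]; exact: Ps.
have [y [s [sn ys Ps _]]] := long N.
by have := bnd _ ys Ps; rewrite /= sn ltnn.
Qed.

Context {R : realType}.
Implicit Types (G : set (homeoI R)) (f g h : homeoI R) (a b c d x y z : R)
  (I J : R * R).

Definition orbital_of G I := exists2 g, G g & is_bump g I.1 I.2.

Definition nests : rel (R * R) :=
  fun I J => [&& I.1 <= J.1, J.2 <= I.2 & I != J].

Definition chain_bound G (N : nat) := forall s, sorted nests s ->
  (forall I, I \in s -> orbital_of G I) -> (size s <= N)%N.

Lemma nests_trans : transitive nests.
Proof.
move=> J I K /and3P[IJ JI neqIJ] /and3P[JK KJ neqJK].
rewrite /nests (le_trans IJ JK) (le_trans KJ JI) /=.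
apply: contraNneq neqIJ => E; move: JK KJ; rewrite -E => JK KJ.
have /eqP E1 : I.1 == J.1 by rewrite eq_le IJ.
have /eqP E2 : I.2 == J.2 by rewrite eq_le KJ.
by apply/eqP; case: I J E1 E2 {IJ JI neqJK E JK KJ} => ? ? [? ?] /= -> ->.
Qed.

Lemma ex_maximal_orbital G N J : chain_bound G N -> orbital_of G J ->
  exists I, [/\ orbital_of G I, I = J \/ nests I J
    & forall K, orbital_of G K -> ~~ nests K I].
Proof. by move=> cG; apply: ex_terminal cG; exact: nests_trans. Qed.

Lemma ex_minimal_orbital G N (P : R * R -> Prop) J : chain_bound G N ->
  (forall I, P I -> orbital_of G I) -> P J ->
  exists2 I, P I & forall K, P K -> ~~ nests I K.
Proof.
move=> cG PG PJ; have [||I [PI _ Imin]] :=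
    @ex_terminal _ (fun I J => nests J I) P N J _ _ PJ.
- by move=> I K L KI IL; exact: nests_trans KI.
- move=> s; rewrite -rev_sorted -size_rev => ss sP; apply: cG => // I.
  by rewrite mem_rev => /sP; exact: PG.
- by exists I.
Qed.

Lemma orbital_up G I : is_subgroup G -> orbital_of G I ->
  exists g, [/\ G g, is_bump g I.1 I.2 & moves_up g I.1 I.2].
Proof.
move=> sG [g Gg bg]; have [up|up] := bump_up_or_down bg; first by exists g.
by exists g^-1%g; split=> //; [exact: subgroupV|exact: bumpV].
Qed.

Lemma orbitalJ G f I : is_subgroup G -> G f -> orbital_of G I ->
  orbital_of G (act f I.1, act f I.2).
Proof.
move=> sG Gf [g Gg bg]; exists (g ^ f^-1)%g; last exact: bumpJ.
by apply: subgroupJ => //; exact: subgroupV.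
Qed.

Section FiniteHeight.
Variables (G : set (homeoI R)) (N : nat).
Hypotheses (sG : is_subgroup G) (cG : chain_bound G N).

(** Otherwise the iterates of [f] would carry the orbital to an infinite
    strictly decreasing sequence of orbitals. *)
Lemma no_self_nesting f I : G f -> orbital_of G I ->
  I.1 <= act f I.1 -> act f I.2 <= I.2 -> act f I.1 = I.1 /\ act f I.2 = I.2.
Proof.
move=> Gf oI f1 f2.
pose F n := (act (f ^+ n)%g I.1, act (f ^+ n)%g I.2).
have oF n : orbital_of G (F n) by apply: orbitalJ => //; exact: subgroupX.
have [||_ [n ->] Fmin] :=
  @ex_minimal_orbital G N (fun J => exists n, J = F n) (F 0%N) cG.
- by move=> _ [n ->].
- by exists 0%N.
have := Fmin _ (ex_intro _ n.+1 erefl).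
rewrite /nests /F expgSr /= !actM !act_le f1 f2 /= negbK => /eqP[].
by move=> /act_inj <- /act_inj <-.
Qed.

(** Two orbitals cannot overlap.  Among the orbitals overlapped from the left,
    take a minimal one, [(c, d)], an orbital of [g], and let [(a, b)], an
    orbital of [f], overlap it; both elements may be taken to move points up.
    Then [k = g^-1 f] moves [c] up and [b] down, so it fixes a point between
    [c] and [b] and has an orbital [(s, t)] with [c < s < b < t].  If [t <= d],
    this orbital contradicts minimality.  If [d < t], then [k] moves [d] down
    as it does [b], so [f d < d] while [c < f c], against [no_self_nesting]. *)
Lemma no_overlap I J : orbital_of G I -> orbital_of G J ->
  I.1 < J.1 -> J.1 < I.2 -> ~ I.2 < J.2.
Proof.
move=> oI oJ ac cb bd.
pose overlapped K := orbital_of G K /\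
  exists I, [/\ orbital_of G I, I.1 < K.1, K.1 < I.2 & I.2 < K.2].
have [||K [oK [L [oL LK1 KL LK2]]] Kmin] :=
    @ex_minimal_orbital G N overlapped J cG.
- by move=> K [].
- by split=> //; exists I.
have [f [Gf bf fup]] := orbital_up sG oL.
have [g [Gg bg gup]] := orbital_up sG oK.
case: (bf) => _ _ fb _; case: (bg) => _ gc gd _.
have fc := fup _ LK1 KL.
have gb := gup _ KL LK2.
pose k := (g^-1 * f)%g.
have Gk : G k by apply: subgroupM => //; exact: subgroupV.
have kc : K.1 < act k K.1 by rewrite actM -(act_lt g) actVK gc.
have kb : act k L.2 < L.2 by rewrite actM fb actV_lt.
have [s [/andP[cs sb] ks]] := act_fix_between_down KL kc kb.
have kb_neq : act k L.2 <> L.2 by apply/eqP; rewrite lt_eqF.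
have [p [q [bk /andP[pb bq]]]] := bump_around kb_neq.
have sp : s <= p.
  rewrite leNgt; apply/negP => ps; case: bk => _ _ _ /(_ s ps); apply=> //.
  exact: lt_trans bq.
have cp : K.1 < p by exact: lt_le_trans sp.
have [qd|dq] := leP q K.2.
  have /Kmin/negP : overlapped (p, q).
    by split; [exists k|exists L; split=> //=; exact: lt_trans cp].
  apply; rewrite /nests /= (ltW cp) qd /=.
  by apply: contraTneq cp => ->; rewrite ltxx.
have kd : act k K.2 < K.2.
  have [up|down] := bump_up_or_down bk.
    by have := lt_trans kb (up _ pb bq); rewrite ltxx.
  by rewrite -actV_gt; apply: down => //; exact: lt_trans LK2.
have fd : act f K.2 < K.2 by move: kd; rewrite actM -(act_lt g) actVK gd.
have [fcE _] := no_self_nesting Gf oK (ltW fc) (ltW fd).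
by rewrite fcE ltxx in fc.
Qed.

(** Orbitals being nested or disjoint, an element moving an endpoint of an
    orbital moves it within an orbital that is strictly larger. *)
Lemma moved_endpoint_nests h I : G h -> orbital_of G I ->
  act h I.1 <> I.1 \/ act h I.2 <> I.2 ->
  exists J, is_bump h J.1 J.2 /\ nests J I.
Proof.
move=> Gh oI; have [g Gg [I12 _ _ _]] := oI.
case=> /bump_around[p [q [bh /andP[px xq]]]];
  have oJ : orbital_of G (p, q) by exists h.
- have Iq : I.2 <= q by rewrite leNgt; apply/negP; exact: (no_overlap oJ oI px xq).
  exists (p, q); split=> //; rewrite /nests /= (ltW px) Iq /=.
  by apply: contraTneq px => <-; rewrite ltxx.
- have pI : p <= I.1.
    by rewrite leNgt; apply/negP => Ip; exact: (no_overlap oI oJ Ip px xq).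
  exists (p, q); split=> //; rewrite /nests /= (ltW xq) pI /=.
  by apply: contraTneq xq => <-; rewrite ltxx.
Qed.

(** If [h] moved [c] or [d], its orbital there would contain [(c, d)], hence
    the fixed point [x]. *)
Lemma bump_fixed_endpoints g h c d x : G g -> G h -> is_bump g c d ->
  c < x < d -> act h x = x -> act h c = c /\ act h d = d.
Proof.
move=> Gg Gh bg /andP[cx xd] hx.
suff noJ : ~ (exists J, is_bump h J.1 J.2 /\ nests J (c, d)).
  have oI : orbital_of G (c, d) by exists g.
  split; apply: contrapT => hne; apply: noJ.
    by apply: (moved_endpoint_nests Gh oI); left.
  by apply: (moved_endpoint_nests Gh oI); right.
case=> J [[_ _ _ hJ] /and3P[/= Jc dJ _]].
by apply: (hJ x) => //; [exact: le_lt_trans cx|exact: lt_le_trans dJ].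
Qed.

(** * The action on a maximal orbital *)

Section MaximalOrbital.
Variables (a b : R).
Hypothesis oA : orbital_of G (a, b).
Hypothesis maxA : forall K, orbital_of G K -> ~~ nests K (a, b).

Let ab : a < b. Proof. by case: oA => ? _ []. Qed.

(** Otherwise [h] would have an orbital strictly larger than [(a, b)]. *)
Lemma maximal_orbital_fixed h : G h -> act h a = a /\ act h b = b.
Proof.
move=> Gh.
have noJ : ~ (exists J, is_bump h J.1 J.2 /\ nests J (a, b)).
  by case=> J [bJ]; apply/negP/maxA; exists h.
split; apply: contrapT => hne; apply: noJ.
  by apply: (moved_endpoint_nests Gh oA); left.
by apply: (moved_endpoint_nests Gh oA); right.
Qed.

Let act_in h x : G h -> a < x < b -> a < act h x < b.
Proof.
by move=> /maximal_orbital_fixed[ha hb]; rewrite -{2}ha -{2}hb !act_lt.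
Qed.

Let trichotomy h : G h ->
  [\/ moves_up h a b, moves_up h^-1%g a b
    | exists x, a < x < b /\ act h x = x].
Proof.
move=> Gh; have [fx|nofx] := pselect (exists x, a < x < b /\ act h x = x).
  exact: Or33.
have [ha hb] := maximal_orbital_fixed Gh.
have bh : is_bump h a b.
  by split=> // x ax xb hx; apply: nofx; exists x; rewrite ax xb.
by case: (bump_up_or_down bh) => up; [exact: Or31|exact: Or32].
Qed.

(** If [g] and [h] fix points [y] and [x] of a maximal orbital and [g] moves
    [x], then [h] fixes both endpoints of the orbital of [g] around [x], and
    one of these is inside the maximal orbital. *)
Lemma fixed_point_mul g h : G g -> G h ->
  (exists y, a < y < b /\ act g y = y) -> (exists x, a < x < b /\ act h x = x) ->
  exists z, a < z < b /\ act (g * h)%g z = z.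
Proof.
move=> Gg Gh [y [/andP[ay yb] gy]] [x [/andP[ax xb] hx]].
have [gx|gx] := pselect (act g x = x).
  by exists x; rewrite ax xb actM hx gx.
have [c [d [bg /andP[cx xd]]]] := bump_around gx.
have cxd : c < x < d by rewrite cx.
have [hc hd] := bump_fixed_endpoints Gg Gh bg cxd hx.
have [ga gb] := maximal_orbital_fixed Gg.
case: (bg) => cd gc gd gfree.
have ac : a <= c.
  by rewrite leNgt; apply/negP => ca; apply: (gfree a ca) => //; exact: lt_trans xd.
have db : d <= b.
  by rewrite leNgt; apply/negP => bd; apply: (gfree b) => //; exact: lt_trans xb.
have [{}ac|ca] := ltP a c.
  by exists c; rewrite ac (lt_trans cx xb) actM hc gc.
have [{}db|bd] := ltP d b.
  by exists d; rewrite db (lt_trans ax xd) actM hd gd.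
by case: (gfree y (le_lt_trans ca ay) (lt_le_trans yb bd)).
Qed.

(** The elements that are nonnegative in the preorder comparing actions on
    [(a, b)].  Moving a single point weakly up is enough: an element that fixes
    a point of [(a, b)] is equivalent to [1]. *)
Definition cone_of (h : homeoI R) := G h /\ exists x, a < x < b /\ x <= act h x.

Let coneP h : cone_of h -> ~ moves_up h^-1%g a b.
Proof.
case=> Gh [x [/andP[ax xb]]]; rewrite leNgt => /negP xh /(_ x ax xb).
by rewrite actV_gt.
Qed.

(** Closure under products reduces to [fixed_point_mul] when neither factor
    moves all of [(a, b)] up, and the archimedean property is
    [orbit_cofinal]. *)
Lemma maximal_orbital_cone : archimedean_cone G cone_of.
Proof.
split.
- by move=> h [].
- split; first exact: subgroup1.
  by exists ((a + b) / 2); rewrite act1; split=> //; move: ab; lra.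
- move=> p q Qp Qq; have [Gp [y [yab py]]] := Qp; have [Gq [x [xab qx]]] := Qq.
  split; first exact: subgroupM.
  have [up|/coneP//|[z [zab pz]]] := trichotomy Gp.
    exists x; split=> //; rewrite actM (le_trans qx)// ltW//.
    by have /andP[] := act_in Gq xab; exact: up.
  have [up|/coneP//|fq] := trichotomy Gq.
    exists (act q^-1%g z); have zab' := act_in (subgroupV sG Gq) zab; split=> //.
    rewrite actM actVK pz -[leRHS](actVK q).
    by have /andP[az zb] := zab'; exact/ltW/up.
  have [|w [wab pqw]] := @fixed_point_mul p q Gp Gq _ fq; first by exists z.
  by exists w; rewrite pqw.
- move=> q g [Gq [x [xab qx]]] Gg; split; first exact: subgroupJ.
  exists (act g^-1%g x); split; first exact: act_in (subgroupV sG Gg) xab.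
  by rewrite conjgE !actM actVK act_le.
- move=> g Gg; have mab : a < (a + b) / 2 < b by move: ab; lra.
  have [h|h] := leP ((a + b) / 2) (act g ((a + b) / 2)); [left|right].
    by split=> //; exists ((a + b) / 2).
  by split; [exact: subgroupV|exists ((a + b) / 2); rewrite ltW// actV_gt].
- move=> f g Gf Gg nQf.
  have up : moves_up f a b.
    move=> x ax xb; rewrite -actV_lt ltNge; apply/negP => xf; apply: nQf.
    split; first exact: subgroupV.
    by exists x; rewrite ax xb.
  have [fa fb] := maximal_orbital_fixed Gf.
  have bf : is_bump f a b.
    by split=> // x ax xb; apply/eqP; rewrite gt_eqF// up.
  have mab : a < (a + b) / 2 < b by move: ab; lra.
  have /andP[_ gmb] := act_in Gg mab.
  have [n gfn] := orbit_cofinal bf up mab gmb.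
  exists n; split; first by apply: subgroupM; [|exact: subgroupV|exact: subgroupX].
  by exists ((a + b) / 2); split=> //; rewrite actM -(act_le g) actVK ltW.
Qed.

(** By Hoelder's argument a commutator is infinitesimal for the cone, that is,
    it has a fixed point in the maximal orbital; and the elements which have one
    form a subgroup. *)
Lemma derived_fixed_point g : derived_subgroup G g ->
  exists x, a < x < b /\ act g x = x.
Proof.
pose K : set (homeoI R) := [set h | G h /\ exists x, a < x < b /\ act h x = x].
suff sub : derived_subgroup G `<=` K by move=> /sub[].
apply: derived_subgroup_sub.
  apply/is_subgroupP; split.
    by split; [exact: subgroup1|exists ((a + b) / 2); rewrite act1; split=> //; move: ab; lra].
  move=> f h [Gf fx] [Gh [x [xab hx]]]; have GV := subgroupV sG Gh.
  split; first exact: subgroupM.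
  by apply: fixed_point_mul => //; exists x; rewrite actV_fix.
move=> f h Gf Gh; split; first exact: subgroupR.
have cone1 := commg_in_cone sG maximal_orbital_cone Gf Gh.
have cone2 := commg_in_cone sG maximal_orbital_cone Gh Gf.
have [up|/(coneP cone1)//|//] := trichotomy (subgroupR sG Gf Gh).
by case: (coneP cone2); rewrite invgR.
Qed.

End MaximalOrbital.

(** A chain of orbitals of the derived subgroup can be extended: its largest
    term lies in a maximal orbital of the group, and strictly so since the
    derived subgroup has no orbital that is maximal for the group. *)
Lemma derived_chain_bound : chain_bound (derived_subgroup G) N.-1.
Proof.
have oD I : orbital_of (derived_subgroup G) I -> orbital_of G I.
  by move=> [g Dg bg]; exists g => //; exact: derived_subgroup_sub_self.
move=> [//|J s] sJ oJ.
have oJ' := oJ _ (mem_head _ _); have [g Dg [_ _ _ gfree]] := oJ'.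
have [[a b] [oI IJ maxI]] := ex_maximal_orbital cG (oD _ oJ').
have [x [/andP[ax xb] gx]] := derived_fixed_point oI maxI Dg.
have {}IJ : nests (a, b) J.
  by case: IJ => // EJ; case: (gfree x); rewrite -?EJ.
have /= := @cG ((a, b) :: J :: s); rewrite IJ => /(_ sJ) H.
have {}H : ((size s).+2 <= N)%N.
  by apply: H => K; rewrite inE => /predU1P[->//|Ks]; exact/oD/oJ.
by rewrite -ltnS (ltn_predK H).
Qed.

End FiniteHeight.

Lemma chain_bound0 G : is_subgroup G -> chain_bound G 0 -> G = [set 1%g].
Proof.
move=> sG cG; apply/seteqP; split=> [g Gg|_ ->]; last exact: subgroup1.
apply: act_eq1 => x; apply: contrapT => /bump_around[a [b [bg _]]].
suff /(@cG [:: (a, b)] isT) : forall I, I \in [:: (a, b)] -> orbital_of G I by [].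
by move=> I; rewrite inE => /eqP ->; exists g.
Qed.

Lemma chain_bound_derived_length G N : is_subgroup G -> chain_bound G N ->
  exists2 n, (n <= N)%N & has_derived_length G n.
Proof.
move=> sG cG.
have sD n : is_subgroup (derived_series G n).
  by case: n => [//|n]; exact: generated_subgroup.
have cD n : chain_bound (derived_series G n) (N - n).
  elim: n => [|n IHn]; first by rewrite subn0.
  by rewrite subnS; exact: derived_chain_bound.
have DN : derived_series G N = [set 1%g].
  by apply: chain_bound0 => //; rewrite -(subnn N).
have exD : exists n, `[< derived_series G n = [set 1%g] >] by exists N; exact/asboolP.
exists (ex_minn exD); case: ex_minnP => n /asboolP Dn minn.
  by apply: minn; exact/asboolP.
by split=> // m Dm; apply: minn; exact/asboolP.
Qed.

End Chains.

(** * Bumps as orbitals, chains as towers *)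

Section Towers.
Local Open Scope classical_set_scope.
Local Open Scope ring_scope.
Context {R : realType}.
Implicit Types (G : set (homeoI R)) (f g h : homeoI R) (a b c d x y z : R)
  (I J : R * R).

Definition oitv I : set R := `]I.1, I.2[.

Lemma oitv_inj I J : I.1 < I.2 -> J.1 < J.2 -> oitv I = oitv J -> I = J.
Proof.
case: I J => a b [c d] /= ab cd E.
have := congr1 inf E; have := congr1 sup E.
by rewrite /oitv /= !sup_itv ?inf_itv ?bnd_simp// => -> ->.
Qed.

Lemma convex_oitv I : @convex_set R R^o (oitv I).
Proof.
move=> x y t; rewrite !inE /oitv /= !in_itv /=.
rewrite [conv t x y](_ : _ = t%:num * x + (1 - t%:num) * y :> R)// => /andP[ax xb] /andP[ay yb].
have : 0 <= t%:num <= 1 by rewrite ge0 le1.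
move: (t%:num) => k /andP[k0 k1].
have [xy|yx] := leP x y.
  have := mulr_ge0 k0 (eqbRL (subr_ge0 _ _) xy).
  have := mulr_ge0 (eqbRL (subr_ge0 _ _) k1) (eqbRL (subr_ge0 _ _) xy).
  by move=> *; apply/andP; split; nra.
have := mulr_ge0 k0 (eqbRL (subr_ge0 _ _) (ltW yx)).
have := mulr_ge0 (eqbRL (subr_ge0 _ _) k1) (eqbRL (subr_ge0 _ _) (ltW yx)).
by move=> *; apply/andP; split; nra.
Qed.

Lemma convex_between (C : set R) x y z : @convex_set R R^o C ->
  C x -> C z -> x <= y <= z -> C y.
Proof.
move=> cC Cx Cz /andP[xy yz]; have [xz|zx] := ltP x z; last first.
  by have -> : y = x by apply/eqP; rewrite eq_le xy (le_trans yz).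
have t0 : 0 <= (y - x) / (z - x) by rewrite divr_ge0// subr_ge0// ltW.
have t1 : (y - x) / (z - x) <= 1 by rewrite ler_pdivrMr ?subr_gt0// mul1r lerD2r.
have := cC z x (Itv01 t0 t1); rewrite !inE => /(_ Cz Cx).
rewrite [conv _ _ _](_ : _ = y :> R)//.
rewrite -[LHS]/((y - x) / (z - x) * z + (1 - (y - x) / (z - x)) * x).
by field; rewrite subr_eq0 gt_eqF.
Qed.

(** The orbit of the midpoint is cofinal in both directions and stays between
    the fixed endpoints. *)
Lemma bump_is_orbital g a b : is_bump g a b ->
  is_orbital (generated [set g]) (oitv (a, b)).
Proof.
move=> bg; have [ab ga gb gfree] := bg; pose m := (a + b) / 2.
have am : a < m by rewrite /m; lra.
have mb : m < b by rewrite /m; lra.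
have /itv01P[u um] : 0 <= m <= 1.
  by apply: contrapT => /negP /(act_out g); apply: gfree.
pose H := generated [set g]; have sH : is_subgroup H by exact: generated_subgroup.
have Hg : H g by move=> K [_]; exact.
have orbitE h : \val (h u) = act h m by rewrite -act_val um.
have [h [Hh bh up]] : exists h, [/\ H h, is_bump h a b & moves_up h a b].
  have [up|up] := bump_up_or_down bg; first by exists g.
  exists g^-1%g; split=> //; last exact: bumpV.
  exact: (subgroupV sH).
exists u; last first.
  move=> /(_ m ((m + b) / 2)); rewrite /oitv /= !in_itv /= => E.
  by have := E _ _; move: mb; lra.
apply/seteqP; split=> [y|].
  rewrite /oitv /= in_itv /= => /andP[ay yb] C [/= cC orbC].
  have HX n : H (h ^+ n)%g by apply: (subgroupX _ sH).
  have [n yn] := orbit_cofinal bh up (introT andP (conj am mb)) yb.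
  have [k mk] := orbit_cofinal bh up (introT andP (conj ay yb)) mb.
  apply: (@convex_between C (act (h ^- k)%g m) y (act (h ^+ n)%g m)) => //.
  - by rewrite -orbitE; apply: orbC; exists (h ^- k)%g => //; exact: (subgroupV sH).
  - by rewrite -orbitE; apply: orbC; exists (h ^+ n)%g => //; exact: HX.
  - by rewrite (ltW yn) andbT -(act_le (h ^+ k)%g) actVK ltW.
apply: smallest_sub; first exact: convex_oitv.
move=> _ [k Hk <-]; rewrite orbitE.
suff fixab : H `<=` [set k | act k a = a /\ act k b = b].
  by have [ka kb] := fixab _ Hk; rewrite /oitv /= in_itv /= -{1}ka -{1}kb !act_lt am.
apply: smallest_sub; last by move=> _ ->.
apply/is_subgroupP; split; first by rewrite /= !act1.
by move=> p q [pa pb] [qa qb]; rewrite /= !actM !(actV_fix qa, actV_fix qb).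
Qed.

Lemma sorted_nests_total (s : seq (R * R)) I J : sorted nests s ->
  I \in s -> J \in s -> [\/ I = J, nests I J | nests J I].
Proof.
elim: s => //= K s IHs; rewrite (path_sortedE nests_trans) => /andP[/allP Ks ss].
rewrite !inE => /predU1P[->|Is] /predU1P[->|Js].
- exact: Or31.
- exact/Or32/Ks.
- exact/Or33/Ks.
- exact: IHs.
Qed.

Lemma nests_sub I J : nests I J -> oitv J `<=` oitv I.
Proof.
case/and3P=> IJ JI _ x; rewrite /oitv /= !in_itv /= => /andP[Jx xJ].
by rewrite (le_lt_trans IJ Jx) (lt_le_trans xJ JI).
Qed.

(** Signatures are chosen as a function of the interval, which makes them
    unique. *)
Lemma chain_tower G (s : seq (R * R)) : sorted nests s ->
  (forall I, I \in s -> orbital_of G I) ->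
  exists2 T, is_tower G T & tower_height T = (size s)%:R%:E.
Proof.
move=> ss oG.
pose sig I := xget 1%g [set g | G g /\ is_bump g I.1 I.2].
have sigP I : I \in s -> G (sig I) /\ is_bump (sig I) I.1 I.2.
  move=> /oG[g Gg bg].
  have /(xgetPex 1%g)// : exists h, [set g | G g /\ is_bump g I.1 I.2] h.
  by exists g.
have ltI I : I \in s -> I.1 < I.2 by move=> /sigP[_ []].
pose T := [set (oitv I, sig I) | I in [set` s]].
have TE : tower_intervals T = [set` [fset A in map oitv s]%fset].
  apply/seteqP; split=> [_ [_ [I /= Is <-] <-]|A] /=.
    by rewrite in_fset; apply/mapP; exists I.
  by rewrite in_fset => /mapP[I Is ->]; exists (oitv I, sig I) => //; exists I.
exists T.
  split.
  - move=> _ [I /= Is <-]; have [Gs bs] := sigP I Is.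
    by split=> //=; case: I bs {Is Gs} => a b; exact: bump_is_orbital.
  - move=> _ _ [_ [I /= Is <-] <-] [_ [J /= Js <-] <-] /=.
    have [->|IJ|JI] := sorted_nests_total ss Is Js; first by left.
      by right; exact: nests_sub.
    by left; exact: nests_sub.
  - move=> _ [_ [I /= Is <-] <-] /=; exists (sig I); split; first by exists I.
    by move=> g [J /= Js [/oitv_inj E <-]]; rewrite E//; exact: ltI.
rewrite /tower_height /counting TE asboolT; last exact: finite_fset.
rewrite set_fsetK card_fseq undup_id ?size_map// map_inj_in_uniq.
  apply: (sorted_uniq nests_trans _ ss) => I; by rewrite /nests eqxx !andbF.
by move=> I J Is Js; apply: oitv_inj; exact: ltI.
Qed.

Lemma height_chain_bound G (N : nat) : height G = (N%:R%:E)%E -> chain_bound G N.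
Proof.
move=> hG s ss oG; have [T tT hT] := chain_tower ss oG.
have : (tower_height T <= height G)%E by apply: ereal_sup_ubound; exists T.
by rewrite hT hG lee_fin ler_nat.
Qed.

End Towers.

Theorem theorem1p3 (R : realType) (Gamma : set (homeoI R)) (N : nat)
    (subgroup_Gamma : is_subgroup Gamma)
    (height_Gamma : height Gamma = (N%:R%:E)%R%E) :
  exists2 n : nat, (n <= N)%N & has_derived_length Gamma n.
Proof.
by apply: chain_bound_derived_length => //; exact: height_chain_bound.
Qed.
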